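(* Consider the planar Newtonian 4-body problem. Suppose that a planar central configuration of four bodies with positive masses is a concave kite and that the masses consist of two pairs of equal masses. Then one pair of equal masses lies at the two endpoints of the base of an isosceles triangle, and the other pair lies on the symmetry axis of that base, with one body of this second pair lying inside the triangle formed by the other three bodies. Moreover, these concave kite central configurations (considered up to equivalence) form a single-parameter family: normalizing $m_1=m_2=1$ at $q_1=(-1,0)$, $q_2=(1,0)$ and $m_3=m_4=m$ at $q_3=(0,\sqrt{a^2-1})$, $q_4=(0,\sqrt{b^2-1})$ with $1<a<b$ (so $a=|q_1-q_3|$, $b=|q_1-q_4|$), the family is parameterized by $a\in(1,2)$, in the sense that each such $a$ uniquely determines $b$ and the mass ratio $m>0$.
   Context: Bodies with positive masses $m_i$ at positions $q_i\in\mathbb{R}^2$, $i=1,\dots,4$, with mutual distances $r_{ij}=|q_i-q_j|$ and Newtonian potential $U=\sum_{i<j} m_im_j/r_{ij}$. A configuration $q=(q_1,\dots,q_4)$ is a central configuration if there is a constant $\lambda$ such that $-\lambda m_j(q_j-c)=\sum_{i\neq j} m_im_j(q_i-q_j)/r_{ij}^3$ for all $j$, where $c=\sum m_iq_i/\sum m_i$ is the center of mass. Two central configurations are equivalent if one is obtained from the other by translation, dilation and rotation. A non-collinear configuration is a kite if it has a symmetry axis passing through two of the four bodies; it is (strictly) concave if one body lies in the interior of the triangle formed by the other three. *)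

(* Defs.v *)
From HB Require Import structures.
From mathcomp Require Import all_boot all_order all_algebra.
From mathcomp Require Import reals.
Set Implicit Arguments. Unset Strict Implicit. Unset Printing Implicit Defensive.
Import Order.TTheory GRing.Theory Num.Theory.
Local Open Scope ring_scope.

Section Defs.
Variable R : realType.

Definition pt := (R * R)%type.

Definition dist (p q : pt) : R :=
  Num.sqrt ((p.1 - q.1) ^+ 2 + (p.2 - q.2) ^+ 2).

Definition total_mass (m : 'I_4 -> R) : R := \sum_(i < 4) m i.

Definition center_of_mass (m : 'I_4 -> R) (q : 'I_4 -> pt) : pt :=
  ((\sum_(i < 4) m i * (q i).1) / total_mass m,
   (\sum_(i < 4) m i * (q i).2) / total_mass m).

(* no two bodies coincide (central configurations are collision-free,
   otherwise the r_ij^-3 terms are undefined) *)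
Definition noncollision (q : 'I_4 -> pt) : Prop :=
  forall i j : 'I_4, i != j -> q i <> q j.

Definition central_configuration (m : 'I_4 -> R) (q : 'I_4 -> pt) : Prop :=
  noncollision q /\
  exists lam : R, forall j : 'I_4,
    - lam * m j * ((q j).1 - (center_of_mass m q).1) =
      \sum_(i < 4 | i != j) m i * m j * ((q i).1 - (q j).1) / dist (q i) (q j) ^+ 3
    /\
    - lam * m j * ((q j).2 - (center_of_mass m q).2) =
      \sum_(i < 4 | i != j) m i * m j * ((q i).2 - (q j).2) / dist (q i) (q j) ^+ 3.

Definition collinear (q : 'I_4 -> pt) : Prop :=
  exists a b c : R, (a != 0 \/ b != 0) /\
    forall i : 'I_4, a * (q i).1 + b * (q i).2 = c.

Definition reflect_line (p1 p2 x : pt) : pt :=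
  let d1 := p2.1 - p1.1 in let d2 := p2.2 - p1.2 in
  let v1 := x.1 - p1.1 in let v2 := x.2 - p1.2 in
  let t := (v1 * d1 + v2 * d2) / (d1 ^+ 2 + d2 ^+ 2) in
  (p1.1 + 2 * t * d1 - v1, p1.2 + 2 * t * d2 - v2).

Definition symmetry_axis (q : 'I_4 -> pt) (k l : 'I_4) : Prop :=
  k != l /\ q k <> q l /\
  forall i : 'I_4, exists j : 'I_4, reflect_line (q k) (q l) (q i) = q j.

Definition kite (q : 'I_4 -> pt) : Prop :=
  ~ collinear q /\ exists k l : 'I_4, symmetry_axis q k l.

Definition in_triangle_interior (x a b c : pt) : Prop :=
  exists al be ga : R, 0 < al /\ 0 < be /\ 0 < ga /\ al + be + ga = 1 /\
    x = (al * a.1 + be * b.1 + ga * c.1, al * a.2 + be * b.2 + ga * c.2).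

Definition distinct4 (i j k l : 'I_4) : Prop :=
  (i != j) && (i != k) && (i != l) && (j != k) && (j != l) && (k != l).

Definition concave (q : 'I_4 -> pt) : Prop :=
  exists i j k l : 'I_4, distinct4 i j k l /\
    in_triangle_interior (q l) (q i) (q j) (q k).

Definition two_pairs_equal (m : 'I_4 -> R) : Prop :=
  exists i j k l : 'I_4, distinct4 i j k l /\ m i = m j /\ m k = m l.

Definition norm_masses (mu : R) (i : 'I_4) : R :=
  if (val i < 2)%N then 1 else mu.

Definition norm_pos (a b : R) (i : 'I_4) : pt :=
  match val i with
  | 0%N => (-1, 0)
  | 1%N => (1, 0)
  | 2%N => (0, Num.sqrt (a ^+ 2 - 1))
  | _ => (0, Num.sqrt (b ^+ 2 - 1))
  end.

Definition similar_image (q q' : 'I_4 -> pt) : Prop :=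
  exists (s c sn t1 t2 : R), 0 < s /\ c ^+ 2 + sn ^+ 2 = 1 /\
    forall i : 'I_4,
      q' i = (t1 + s * (c * (q i).1 - sn * (q i).2),
              t2 + s * (sn * (q i).1 + c * (q i).2)).

End Defs.

(* Main.v *)
(* A kite whose axis carries bodies 2 and 3 is, up to a similarity of the plane,
   (-1,0), (1,0), (0,x), (0,y), and concavity allows 0 < x < y. Write A, B, D for
   the inverse cubes of a = sqrt(1+x^2), b = sqrt(1+y^2), y-x. The horizontal
   equations of the axis bodies read lam c = (m1-m0) A = (m1-m0) B, so m0 = m1,
   and two equal pairs of masses force m2 = m3. With masses 1, 1, mu, mu the
   remaining equations reduce to
     mu (y-x) (D-B) = 2 x (A-1/8),    mu (y-x) (D-A) = 2 y (1/8-B).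
   Signs give a < 2. Since D > B, the first one determines mu > 0 from y, and y
   must solve
     y (1/8-B) = x (A-1/8) (1 - (A-B)/(D-B)).
   Every solution has y > 1, where the left side is strictly increasing and the
   right side strictly decreasing in y, hence uniqueness. The two sides compare in
   opposite ways at y = sqrt 3 (where B = 1/8) and y = x+a (where D = A), hence
   existence by the intermediate value theorem. *)
Require Import Defs.
From HB Require Import structures.
From mathcomp Require Import all_boot all_order all_algebra.
From mathcomp Require Import reals.
From mathcomp Require Import boolp topology normedtype realfun ring lra.
Set Implicit Arguments. Unset Strict Implicit. Unset Printing Implicit Defensive.
Import Order.TTheory GRing.Theory Num.Theory numFieldNormedType.Exports.
Local Open Scope ring_scope.

(** * Case analysis and sums over four bodies *)

Local Notation o0 := (@Ordinal 4 0 isT).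
Local Notation o1 := (@Ordinal 4 1 isT).
Local Notation o2 := (@Ordinal 4 2 isT).
Local Notation o3 := (@Ordinal 4 3 isT).

Lemma forall_I4 (P : 'I_4 -> Prop) :
  P o0 -> P o1 -> P o2 -> P o3 -> forall i, P i.
Proof.
move=> p0 p1 p2 p3 [[|[|[|[|n]]]] // hi].
- by rewrite (_ : Ordinal hi = o0) //; apply: val_inj.
- by rewrite (_ : Ordinal hi = o1) //; apply: val_inj.
- by rewrite (_ : Ordinal hi = o2) //; apply: val_inj.
- by rewrite (_ : Ordinal hi = o3) //; apply: val_inj.
Qed.

Lemma sum_I4 (V : nmodType) (F : 'I_4 -> V) :
  \sum_(i < 4) F i = F o0 + (F o1 + (F o2 + F o3)).
Proof.
rewrite !big_ord_recl big_ord0 addr0.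
by congr (F _ + (F _ + (F _ + F _))); apply: val_inj.
Qed.

(** * Invariance of central configurations under relabelling, mass scaling and similarities *)

Section Similarity.
Variable R : realType.
Implicit Types (m : 'I_4 -> R) (q : 'I_4 -> pt R) (z w p : pt R).

(* The map p |-> z + w p of the complex plane. *)
Definition sim z w p : pt R :=
  (z.1 + (w.1 * p.1 - w.2 * p.2), z.2 + (w.2 * p.1 + w.1 * p.2)).

Lemma cc_reindex m q (sigma : 'I_4 -> 'I_4) : injective sigma ->
  central_configuration m q ->
  central_configuration (fun i => m (sigma i)) (fun i => q (sigma i)).
Proof.
move=> inj_s [ncq [lam eqs]]; split.
  by move=> i j ij; apply: ncq; rewrite (inj_eq inj_s).
have bij P : {on P, bijective sigma} by apply: onW_bij; apply: injF_bij.
exists lam => j; have [eq1 eq2] := eqs (sigma j).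
have -> : center_of_mass (fun i => m (sigma i)) (fun i => q (sigma i)) =
          center_of_mass m q.
  rewrite /center_of_mass /total_mass; congr (_ / _, _ / _);
  by rewrite [RHS](reindex sigma).
split; rewrite ?eq1 ?eq2 [LHS](reindex sigma) //=.
  by apply: eq_bigl => i; rewrite (inj_eq inj_s).
by apply: eq_bigl => i; rewrite (inj_eq inj_s).
Qed.

(** The forces are quadratic in the masses and the other side is linear in them, so [lam] is divided
    by [c]. *)
Lemma cc_scale m q (c : R) : 0 < c ->
  central_configuration (fun i => c * m i) q -> central_configuration m q.
Proof.
move=> c0 [ncq [lam eqs]]; split=> //; exists (lam / c) => j.
have cn : c != 0 by rewrite gt_eqF.
have cmE : center_of_mass (fun i => c * m i) q = center_of_mass m q.
  rewrite /center_of_mass /total_mass -!mulr_sumr.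
  under eq_bigr do rewrite -mulrA.
  under [X in (_, X / _)]eq_bigr do rewrite -mulrA.
  by rewrite -!mulr_sumr -!mulf_div divff // !mul1r.
have [] := eqs j; rewrite cmE => eq1 eq2; split.
- apply: (mulfI (mulf_neq0 cn cn)); rewrite mulr_sumr.
  transitivity (- lam * (c * m j) * ((q j).1 - (center_of_mass m q).1)).
    by field.
  by rewrite eq1; apply: eq_bigr => i _; ring.
- apply: (mulfI (mulf_neq0 cn cn)); rewrite mulr_sumr.
  transitivity (- lam * (c * m j) * ((q j).2 - (center_of_mass m q).2)).
    by field.
  by rewrite eq2; apply: eq_bigr => i _; ring.
Qed.

Lemma dist_neq0 p1 p2 : p1 <> p2 -> dist p1 p2 != 0.
Proof.
case: p1 p2 => [x1 y1] [x2 y2] np; rewrite sqrtr_eq0 -ltNge lt0r.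
rewrite addr_ge0 ?sqr_ge0 // andbT paddr_eq0 ?sqr_ge0 // !sqrf_eq0 !subr_eq0 /=.
by apply/negP => /andP[/eqP e1 /eqP e2]; apply: np; rewrite e1 e2.
Qed.

Lemma dist_sim z w p1 p2 :
  dist (sim z w p1) (sim z w p2) =
  Num.sqrt (w.1 ^+ 2 + w.2 ^+ 2) * dist p1 p2.
Proof.
rewrite /dist -sqrtrM ?addr_ge0 ?sqr_ge0 //; congr Num.sqrt.
by rewrite /sim /=; ring.
Qed.

Lemma sim_inj z w p1 p2 : w.1 ^+ 2 + w.2 ^+ 2 != 0 ->
  sim z w p1 = sim z w p2 -> p1 = p2.
Proof.
case: p1 p2 => [x1 y1] [x2 y2] w0 [/= /addrI e1 /addrI e2].
congr (_, _); apply: (mulfI w0).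
- transitivity (w.1 * (w.1 * x1 - w.2 * y1) + w.2 * (w.2 * x1 + w.1 * y1)).
    by ring.
  by rewrite e1 e2; ring.
- transitivity (w.1 * (w.2 * x1 + w.1 * y1) - w.2 * (w.1 * x1 - w.2 * y1)).
    by ring.
  by rewrite e1 e2; ring.
Qed.

Lemma cc_sim m q z w : (forall i, 0 < m i) -> w.1 ^+ 2 + w.2 ^+ 2 != 0 ->
  central_configuration m (fun i => sim z w (q i)) ->
  central_configuration m q.
Proof.
move=> m0 w0 [ncq [lam eqs]]; split.
  by move=> i j ij qij; apply: (ncq _ _ ij); rewrite qij.
set s := Num.sqrt (w.1 ^+ 2 + w.2 ^+ 2).
have s2 : s ^+ 2 = w.1 ^+ 2 + w.2 ^+ 2.
  by rewrite sqr_sqrtr // addr_ge0 ?sqr_ge0.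
have sn0 : s != 0 by apply: contra w0 => /eqP s0; rewrite -s2 s0 expr0n.
have M0 : total_mass m != 0.
  by rewrite gt_eqF // /total_mass sum_I4 !addr_gt0.
have cmE : center_of_mass m (fun i => sim z w (q i)) =
           sim z w (center_of_mass m q).
  rewrite /center_of_mass /sim /=; congr (_, _); apply: (mulIf M0);
    rewrite divfK // !mulrDl ?mulNr -!(mulrA _ (_ / _)) !divfK //;
    by rewrite /total_mass !sum_I4; ring.
(* A similarity of ratio [s] multiplies positions by [s] and the sums of forces by [s^-2]; hence the
   factor [s^3]. *)
exists (lam * s ^+ 3) => j; have [] := eqs j; rewrite cmE.
under eq_bigr => i _ do rewrite dist_sim -/s.
under [X in _ -> _ = X -> _]eq_bigr => i _ do rewrite dist_sim -/s.
move: (center_of_mass m q) => c; rewrite /sim /= => eq1 eq2.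
(* Multiplication by the conjugate of [w] undoes the rotation: [w1] and [w2] are the real and
   imaginary parts, and the extra [s] turns [|w|^2] into [s^3]. *)
have w1 := congr2 (fun a b => s * (w.1 * a + w.2 * b)) eq1 eq2.
have w2 := congr2 (fun a b => s * (w.1 * b - w.2 * a)) eq1 eq2.
have nd i : i != j -> dist (q i) (q j) != 0.
  by move=> ij; apply: dist_neq0 => qij; apply: (ncq _ _ ij); rewrite qij.
split.
- transitivity
   (s * (w.1 * (- lam * m j * (z.1 + (w.1 * (q j).1 - w.2 * (q j).2) -
                        (z.1 + (w.1 * c.1 - w.2 * c.2)))) +
         w.2 * (- lam * m j * (z.2 + (w.2 * (q j).1 + w.1 * (q j).2) -
                        (z.2 + (w.2 * c.1 + w.1 * c.2)))))).
    by rewrite (exprS s 2) s2; ring.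
  rewrite {}w1 !mulr_sumr -big_split mulr_sumr; apply: eq_bigr => i ij /=.
  have d0 := nd i ij.
  transitivity (s * (w.1 ^+ 2 + w.2 ^+ 2) * (m i * m j * ((q i).1 - (q j).1))
     / (s * dist (q i) (q j)) ^+ 3); first by field; apply/andP.
  by rewrite -s2; field; apply/andP.
- transitivity
   (s * (w.1 * (- lam * m j * (z.2 + (w.2 * (q j).1 + w.1 * (q j).2) -
                        (z.2 + (w.2 * c.1 + w.1 * c.2)))) -
         w.2 * (- lam * m j * (z.1 + (w.1 * (q j).1 - w.2 * (q j).2) -
                        (z.1 + (w.1 * c.1 - w.2 * c.2)))))).
    by rewrite (exprS s 2) s2; ring.
  rewrite {}w2 !mulr_sumr -sumrB mulr_sumr; apply: eq_bigr => i ij /=.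
  have d0 := nd i ij.
  transitivity (s * (w.1 ^+ 2 + w.2 ^+ 2) * (m i * m j * ((q i).2 - (q j).2))
     / (s * dist (q i) (q j)) ^+ 3); first by field; apply/andP.
  by rewrite -s2; field; apply/andP.
Qed.

End Similarity.

(** * Labellings of four bodies *)

Definition sel4 (T : Type) (a b c d : T) (x : 'I_4) : T :=
  match val x with 0%N => a | 1%N => b | 2%N => c | _ => d end.

Lemma sel4_inj i j k l : distinct4 i j k l -> injective (sel4 i j k l).
Proof.
case/andP=> /andP[/andP[/andP[/andP[ij ik] il] jk] jl] kl.
apply: forall_I4; apply: forall_I4; rewrite /sel4 /= => e //;
  by move: ij ik il jk jl kl; rewrite ?e ?eqxx.
Qed.

Lemma distinct4_cover i j k l : distinct4 i j k l ->
  forall x, [\/ x = i, x = j, x = k | x = l].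
Proof.
move=> /sel4_inj/injF_bij[g _ gK] x; rewrite -(gK x).
move: (g x); apply: forall_I4; rewrite /sel4 /=.
- exact: Or41.
- exact: Or42.
- exact: Or43.
- exact: Or44.
Qed.

Lemma distinct4_extend (k l : 'I_4) : k != l ->
  exists i j, distinct4 i j k l.
Proof.
move: k l; apply: forall_I4; apply: forall_I4 => // _;
 first [by exists o0, o1 | by exists o0, o2 | by exists o0, o3
       |by exists o1, o2 | by exists o1, o3 | by exists o2, o3].
Qed.

Lemma distinct4_swap (i j k l : 'I_4) :
  distinct4 i j k l -> distinct4 j i k l.
Proof. by rewrite /distinct4 (eq_sym j i); do ![case: (_ == _)]. Qed.

(** * Coordinates adapted to the symmetry axis *)

Section Frame.
Variable R : realType.
Implicit Types (m : 'I_4 -> R) (q : 'I_4 -> pt R) (z w p : pt R) (x y : R).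

(** The heights of the axis bodies are the parameters here, instead of the side lengths of
    [norm_pos]; this also covers bodies below the base. *)
Definition npos x y : 'I_4 -> pt R := sel4 (-1, 0) (1, 0) (0, x) (0, y).

(** The signs and the order of [x] and [y] are left open; the two swap lemmas adjust them later. *)
Definition framed q (sigma : 'I_4 -> 'I_4) z w x y :=
  [/\ injective sigma, w.1 ^+ 2 + w.2 ^+ 2 != 0, x != y &
      forall i, q (sigma i) = sim z w (npos x y i)].

(** Similarities carry reflections to reflections, and the line through [(0, x)] and [(0, y)] is the
    vertical axis. *)
Lemma reflect_sim z w x y p : w.1 ^+ 2 + w.2 ^+ 2 != 0 -> x != y ->
  reflect_line (sim z w (0, x)) (sim z w (0, y)) (sim z w p) =
  sim z w (- p.1, p.2).
Proof.
move=> w0 xy; have yx : y - x != 0 by rewrite subr_eq0 eq_sym.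
rewrite /reflect_line.
have -> : (sim z w (0, y)).1 - (sim z w (0, x)).1 = - w.2 * (y - x).
  by rewrite /sim /=; ring.
have -> : (sim z w (0, y)).2 - (sim z w (0, x)).2 = w.1 * (y - x).
  by rewrite /sim /=; ring.
have -> : (- w.2 * (y - x)) ^+ 2 + (w.1 * (y - x)) ^+ 2 =
          (w.1 ^+ 2 + w.2 ^+ 2) * (y - x) ^+ 2 by ring.
by congr (_, _); rewrite /sim /=; field; apply/andP.
Qed.

(** The reflection exchanges the two bodies off the axis, so these form the base. *)
Lemma kite_framed q : kite q -> exists sigma z w x y,
  framed q sigma z w x y.
Proof.
case=> ncol [k [l sym]]; have [kl [qkl refl]] := sym.
set d1 := (q l).1 - (q k).1; set d2 := (q l).2 - (q k).2.
have d0 : d1 ^+ 2 + d2 ^+ 2 != 0.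
  rewrite paddr_eq0 ?sqr_ge0 // !sqrf_eq0 !subr_eq0.
  apply/negP => /andP[/eqP e1 /eqP e2]; apply: qkl.
  by case: (q k) (q l) e1 e2 => [? ?] [? ?] /= -> ->.
(* Twice a signed area: [cr] vanishes on the axis and changes sign under the reflection. A body with
   nonzero [cr] is therefore sent neither to itself nor to an axis body. *)
pose cr (p : pt R) := d1 * (p.2 - (q k).2) - d2 * (p.1 - (q k).1).
have crR p : cr (reflect_line (q k) (q l) p) = - cr p.
  by rewrite /cr /reflect_line /= -/d1 -/d2; set t := _ / _; ring.
have crk : cr (q k) = 0 by rewrite /cr; ring.
have crl : cr (q l) = 0 by rewrite /cr /d1 /d2; ring.
have [i0 [j0 D0]] := distinct4_extend kl.
have swapped i j : distinct4 i j k l -> cr (q i) != 0 ->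
    reflect_line (q k) (q l) (q i) = q j.
  move=> D ci; have [x ex] := refl i; rewrite ex.
  have cx : cr (q x) = - cr (q i) by rewrite -crR ex.
  have [xe|-> //|xe|xe] := distinct4_cover D x; exfalso; move: cx ci.
  - by rewrite xe => /eqP; rewrite -addr_eq0 -mulr2n mulrn_eq0 /= => ->.
  - by rewrite xe crk => /esym/eqP; rewrite oppr_eq0 => ->.
  - by rewrite xe crl => /esym/eqP; rewrite oppr_eq0 => ->.
(* If [cr] vanished at both remaining bodies, all four would lie on the axis. *)
have [i [j [D ci]]] : exists i j, distinct4 i j k l /\ cr (q i) != 0.
  have [ci|ci] := eqVneq (cr (q i0)) 0; last by exists i0, j0.
  have [cj|cj] := eqVneq (cr (q j0)) 0; last first.
    by exists j0, i0; split=> //; apply: distinct4_swap.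
  case: ncol; exists (- d2), d1, (d1 * (q k).2 - d2 * (q k).1); split.
    have [e|] := eqVneq d1 0; last by right.
    by left; move: d0; rewrite e expr0n add0r sqrf_eq0 oppr_eq0.
  have key p : cr p = 0 -> - d2 * p.1 + d1 * p.2 = d1 * (q k).2 - d2 * (q k).1.
    by rewrite /cr => cp; apply/eqP; rewrite -subr_eq0 -cp; apply/eqP; ring.
  by move=> x; apply: key; case: (distinct4_cover D0 x) => ->.
have qj := swapped i j D ci.
(* z is the midpoint of the base and w half the base vector; d = q l - q k is
   orthogonal to w, so d = de * (i w). *)
set v1 := (q i).1 - (q k).1; set v2 := (q i).2 - (q k).2.
set t := (v1 * d1 + v2 * d2) / (d1 ^+ 2 + d2 ^+ 2).
have qj1 : (q j).1 = (q k).1 + 2 * t * d1 - v1 by rewrite -qj.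
have qj2 : (q j).2 = (q k).2 + 2 * t * d2 - v2 by rewrite -qj.
pose w : pt R := (t * d1 - v1, t * d2 - v2).
pose z : pt R := ((q k).1 + t * d1, (q k).2 + t * d2).
have wd : w.1 * d1 + w.2 * d2 = 0 by rewrite /w /t /=; field.
have w0 : w.1 ^+ 2 + w.2 ^+ 2 != 0.
  rewrite paddr_eq0 ?sqr_ge0 // !sqrf_eq0.
  apply: contra ci => /andP[/eqP e1 /eqP e2].
  have -> : cr (q i) = d2 * w.1 - d1 * w.2 by rewrite /cr /w /= /v1 /v2; ring.
  by rewrite e1 e2 !mulr0 subr0.
pose de := (d2 * w.1 - d1 * w.2) / (w.1 ^+ 2 + w.2 ^+ 2).
have d1E : d1 = - de * w.2.
  apply: (mulIf w0); rewrite mulrAC mulNr divfK //.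
  transitivity (w.1 * (w.1 * d1 + w.2 * d2) - (d2 * w.1 - d1 * w.2) * w.2).
    by ring.
  by rewrite wd; ring.
have d2E : d2 = de * w.1.
  apply: (mulIf w0); rewrite mulrAC divfK //.
  transitivity (w.2 * (w.1 * d1 + w.2 * d2) + (d2 * w.1 - d1 * w.2) * w.1).
    by ring.
  by rewrite wd; ring.
have de0 : de != 0.
  apply: contra d0 => /eqP e.
  by rewrite d1E d2E e oppr0 !mul0r !expr0n addr0.
(* The midpoint is [z = q k + t d], so the axis bodies are [z - t d] and [z + (1 - t) d], where
   [d = de * (i w)]. *)
exists (sel4 i j k l), z, w, (- t * de), ((1 - t) * de).
split=> //; first exact: sel4_inj.
  by rewrite -subr_eq0 (_ : _ - _ = - de) ?oppr_eq0 //; ring.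
have pairP (p : pt R) a b : p.1 = a -> p.2 = b -> p = (a, b).
  by case: p => ? ? /= -> ->.
apply: forall_I4; rewrite /npos /sel4 /sim /=; apply: pairP.
- by rewrite /v1; ring.
- by rewrite /v2; ring.
- by rewrite qj1; ring.
- by rewrite qj2; ring.
- by rewrite [in RHS]d1E /w /=; ring.
- by rewrite [in RHS]d2E /w /=; ring.
- transitivity ((q k).1 + t * d1 + (1 - t) * (- de * w.2));
    last by rewrite /w /=; ring.
  by rewrite -d1E /d1; ring.
- transitivity ((q k).2 + t * d2 + (1 - t) * (de * w.1));
    last by rewrite /w /=; ring.
  by rewrite -d2E /d2; ring.
Qed.

Lemma interior_sim z w p a b c : w.1 ^+ 2 + w.2 ^+ 2 != 0 ->
  in_triangle_interior (sim z w p) (sim z w a) (sim z w b) (sim z w c) ->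
  in_triangle_interior p a b c.
Proof.
move=> w0 [al [be [ga [al0 [be0 [ga0 [s1 e]]]]]]].
exists al, be, ga; do 4!split=> //; apply: (sim_inj (z := z) w0).
rewrite e /sim /=; have -> : al = 1 - be - ga by rewrite -s1; ring.
by congr (_, _); ring.
Qed.

Lemma sim_interior z w p a b c : in_triangle_interior p a b c ->
  in_triangle_interior (sim z w p) (sim z w a) (sim z w b) (sim z w c).
Proof.
move=> [al [be [ga [al0 [be0 [ga0 [s1 e]]]]]]].
exists al, be, ga; do 4!split=> //.
rewrite e /sim /=; have -> : al = 1 - be - ga by rewrite -s1; ring.
by congr (_, _); ring.
Qed.

(** The base bodies have the extreme horizontal coordinates, so the interior body is on the axis.
    Since the base has height 0, [th] is the barycentric weight of the other axis body. *)
Lemma concave_npos x y : concave (npos x y) ->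
  exists th, 0 < th < 1 /\ (x = th * y \/ y = th * x).
Proof.
case=> [i [j [k [l [D [al [be [ga [a0 [b0 [c0 [s1 e]]]]]]]]]]]].
move: l i j k D e; apply: forall_I4.
- move=> i j k /andP[/andP[/andP[/andP[/andP[_ _] il] _] jl] kl].
  move=> /(congr1 fst) /=.
  have ge0 (n : 'I_4) : n != o0 -> 0 <= (npos x y n).1.
    by move: n; apply: forall_I4 => // _; rewrite /npos /sel4 /=.
  rewrite {1}/npos /= => e.
  suff : 0 <= -1 :> R by lra.
  by rewrite e !addr_ge0 ?mulr_ge0 ?ge0 // ltW.
- move=> i j k /andP[/andP[/andP[/andP[/andP[_ _] il] _] jl] kl].
  move=> /(congr1 fst) /=.
  have le0 (n : 'I_4) : n != o1 -> (npos x y n).1 <= 0.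
    by move: n; apply: forall_I4 => // _; rewrite /npos /sel4 /=; lra.
  rewrite {1}/npos /= => e.
  suff : 1 <= 0 :> R by lra.
  rewrite e; have := le0 _ il; have := le0 _ jl; have := le0 _ kl.
  by move: (npos _ _ i).1 (npos _ _ j).1 (npos _ _ k).1 => *; nra.
- do 3![apply: forall_I4 => //] => _; rewrite /npos /sel4 /= => -[_ e];
    first [exists al; split; [lra|left; rewrite e; ring]
          |exists be; split; [lra|left; rewrite e; ring]
          |exists ga; split; [lra|left; rewrite e; ring]].
- do 3![apply: forall_I4 => //] => _; rewrite /npos /sel4 /= => -[_ e];
    first [exists al; split; [lra|right; rewrite e; ring]
          |exists be; split; [lra|right; rewrite e; ring]
          |exists ga; split; [lra|right; rewrite e; ring]].
Qed.

Lemma framed_swap_base q sigma z w x y : framed q sigma z w x y ->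
  framed q (fun i => sigma (sel4 o1 o0 o2 o3 i)) z (- w.1, - w.2) (- x) (- y).
Proof.
case=> sI w0 xy e; split=> /=.
- by move=> i j /sI; apply: sel4_inj.
- by rewrite !sqrrN.
- by rewrite eqr_opp.
- by apply: forall_I4; rewrite e /npos /sel4 /sim /=; congr (_, _); ring.
Qed.

Lemma framed_swap_axis q sigma z w x y : framed q sigma z w x y ->
  framed q (fun i => sigma (sel4 o0 o1 o3 o2 i)) z w y x.
Proof.
case=> sI w0 xy e; split=> //=.
- by move=> i j /sI; apply: sel4_inj.
- by rewrite eq_sym.
- by apply: forall_I4; rewrite e /npos /sel4 /sim.
Qed.

Lemma framed_concave q sigma z w x y : framed q sigma z w x y ->
  concave q -> concave (npos x y).
Proof.
case=> sI w0 xy e [i [j [k [l [D T]]]]].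
have [g _ gK] := injF_bij sI.
exists (g i), (g j), (g k), (g l); split.
  by rewrite /distinct4 !(inj_eq (can_inj gK)).
by apply: (interior_sim (z := z) w0); rewrite -!e !gK.
Qed.

Lemma concave_kite_framed q : kite q -> concave q -> exists sigma z w x y,
  [/\ framed q sigma z w x y, 0 < x & x < y].
Proof.
move=> /kite_framed[sigma [z [w [x [y fr]]]]] cq.
have [th [/andP[t0 t1] xy]] := concave_npos (framed_concave fr cq).
(* Exchanging the axis bodies makes body 2 the interior one. *)
wlog {xy} xE : sigma x y fr / x = th * y.
  move=> H; case: xy => [xE|yE]; first exact: H fr xE.
  exact: H (framed_swap_axis fr) yE.
(* A half turn of the frame changes the sign of both heights, and [y = 0] would make the axis bodies
   coincide. *)
wlog y0 : sigma z w x y fr xE / 0 < y.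
  move=> H; have [yp|yn|y0] := ltgtP y 0.
  - by apply: H (framed_swap_base fr) _ _; rewrite ?xE ?mulrN ?oppr_gt0.
  - exact: H fr xE yn.
  - by case: fr => _ _; rewrite xE y0 mulr0 eqxx.
exists sigma, z, w, x, y; split=> //; rewrite xE ?mulr_gt0 //.
by rewrite -subr_gt0; nra.
Qed.

End Frame.

(** * The equations of a central configuration in adapted coordinates *)

Section Equations.
Variable R : realType.
Implicit Types (m : 'I_4 -> R) (x y lam : R).

(* The distance from (-1, 0) or (1, 0) to (0, x). *)
Definition hyp x : R := Num.sqrt (1 + x ^+ 2).

Lemma hyp_gt0 x : 0 < hyp x.
Proof. by rewrite sqrtr_gt0 ltr_wpDr ?sqr_ge0 ?ltr01. Qed.

Lemma sqr_hyp x : hyp x ^+ 2 = 1 + x ^+ 2.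
Proof. by rewrite sqr_sqrtr // addr_ge0 ?sqr_ge0. Qed.

Definition icube (r : R) : R := (r ^+ 3)^-1.

Lemma icube_gt0 r : 0 < r -> 0 < icube r.
Proof. by move=> r0; rewrite invr_gt0 exprn_gt0. Qed.

Lemma icube_lt r s : 0 < r -> r < s -> icube s < icube r.
Proof.
move=> r0 rs; have s0 := lt_trans r0 rs.
by rewrite ltf_pV2 ?posrE ?exprn_gt0 // ltrXn2r // ltW.
Qed.

Lemma npos_noncollision x y : 0 < x -> x < y -> noncollision (npos x y).
Proof.
move=> x0 xy.
by apply: forall_I4; apply: forall_I4 => // _; rewrite /npos /sel4 /= => -[] *;
  lra.
Qed.

(** The four conjuncts are the equations of bodies 0 to 3, each divided by plus or minus the mass of
    its body. The center of mass is [(cx, cy)], and the quarter is [2 / 2^3] from the base of length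
    2. *)
Lemma cc_npos m x y : (forall i, 0 < m i) -> 0 < x -> x < y ->
  let M := m o0 + (m o1 + (m o2 + m o3)) in
  let cx := (m o1 - m o0) / M in
  let cy := (m o2 * x + m o3 * y) / M in
  let A := icube (hyp x) in
  let B := icube (hyp y) in
  let D := icube (y - x) in
  central_configuration m (npos x y) <-> exists lam,
    [/\ lam * (1 + cx) = m o1 / 4 + m o2 * A + m o3 * B /\
        lam * cy = m o2 * x * A + m o3 * y * B,
        lam * (1 - cx) = m o0 / 4 + m o2 * A + m o3 * B /\
        lam * cy = m o2 * x * A + m o3 * y * B,
        lam * cx = (m o1 - m o0) * A /\
        lam * (x - cy) = (m o0 + m o1) * x * A - m o3 * (y - x) * D &
        lam * cx = (m o1 - m o0) * B /\
        lam * (y - cy) = (m o0 + m o1) * y * B + m o2 * (y - x) * D].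
Proof.
move=> m0 x0 xy M cx cy A B D.
have cmE : center_of_mass m (npos x y) = (cx, cy).
  rewrite /center_of_mass /total_mass !sum_I4 /npos /sel4 /= -/M.
  by congr (_, _); rewrite /cx /cy; congr (_ / _); ring.
have d01 : dist ((-1, 0) : pt R) (1, 0) = 2.
  rewrite /dist /= (_ : _ + _ = 2 ^+ 2); last by ring.
  by rewrite sqrtr_sqr ger0_norm.
have dC (p1 p2 : pt R) : dist p1 p2 = dist p2 p1.
  by rewrite /dist; congr Num.sqrt; ring.
have d0 t : dist ((-1, 0) : pt R) (0, t) = hyp t.
  by rewrite /dist /hyp /=; congr Num.sqrt; ring.
have d1 t : dist ((1, 0) : pt R) (0, t) = hyp t.
  by rewrite /dist /hyp /=; congr Num.sqrt; ring.
have d23 : dist ((0, x) : pt R) (0, y) = y - x.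
  rewrite /dist /= (_ : _ + _ = (y - x) ^+ 2); last by ring.
  by rewrite sqrtr_sqr ger0_norm // subr_ge0 ltW.
have d0' t : dist ((0, t) : pt R) (-1, 0) = hyp t by rewrite dC d0.
have d1' t : dist ((0, t) : pt R) (1, 0) = hyp t by rewrite dC d1.
have d10 : dist ((1, 0) : pt R) (-1, 0) = 2 by rewrite dC d01.
have d32 : dist ((0, y) : pt R) (0, x) = y - x by rewrite dC d23.
have dE := (d01, d10, d0, d1, d0', d1', d23, d32).
have eqE (mu E S X Y : R) : mu != 0 -> X = mu * E -> Y = mu * S ->
    (X = Y) <-> (E = S).
  by move=> mu0 -> ->; split=> [/(mulfI mu0)|->].
have andE (P P' Q Q' : Prop) : (P <-> P') -> (Q <-> Q') ->
    (P /\ Q) <-> (P' /\ Q') by tauto.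
pose force lam j :=
  - lam * m j * ((npos x y j).1 - cx) =
    \sum_(i < 4 | i != j) m i * m j * ((npos x y i).1 - (npos x y j).1)
                            / dist (npos x y i) (npos x y j) ^+ 3 /\
  - lam * m j * ((npos x y j).2 - cy) =
    \sum_(i < 4 | i != j) m i * m j * ((npos x y i).2 - (npos x y j).2)
                            / dist (npos x y i) (npos x y j) ^+ 3.
have mn0 i : m i != 0 by rewrite gt_eqF.
have AE : (hyp x ^+ 3)^-1 = A by [].
have BE : (hyp y ^+ 3)^-1 = B by [].
have DE : ((y - x) ^+ 3)^-1 = D by [].
have mnN i : - m i != 0 by rewrite oppr_eq0.
have f0 lam : force lam o0 <->
    lam * (1 + cx) = m o1 / 4 + m o2 * A + m o3 * B /\
    lam * cy = m o2 * x * A + m o3 * y * B.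
  apply: andE; apply: (eqE _ _ _ _ _ (mn0 o0));
    by rewrite ?big_mkcond ?sum_I4 /npos /sel4 /= ?dE ?AE ?BE ?DE; field.
have f1 lam : force lam o1 <->
    lam * (1 - cx) = m o0 / 4 + m o2 * A + m o3 * B /\
    lam * cy = m o2 * x * A + m o3 * y * B.
  apply: andE;
    [apply: (eqE _ _ _ _ _ (mnN o1))|apply: (eqE _ _ _ _ _ (mn0 o1))];
    by rewrite ?big_mkcond ?sum_I4 /npos /sel4 /= ?dE ?AE ?BE ?DE; field.
have f2 lam : force lam o2 <->
    lam * cx = (m o1 - m o0) * A /\
    lam * (x - cy) = (m o0 + m o1) * x * A - m o3 * (y - x) * D.
  apply: andE;
    [apply: (eqE _ _ _ _ _ (mn0 o2))|apply: (eqE _ _ _ _ _ (mnN o2))];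
    by rewrite ?big_mkcond ?sum_I4 /npos /sel4 /= ?dE ?AE ?BE ?DE; field.
have f3 lam : force lam o3 <->
    lam * cx = (m o1 - m o0) * B /\
    lam * (y - cy) = (m o0 + m o1) * y * B + m o2 * (y - x) * D.
  apply: andE;
    [apply: (eqE _ _ _ _ _ (mn0 o3))|apply: (eqE _ _ _ _ _ (mnN o3))];
    by rewrite ?big_mkcond ?sum_I4 /npos /sel4 /= ?dE ?AE ?BE ?DE; field.
rewrite /central_configuration cmE /=; split.
  case=> _ [lam e]; exists lam; split;
    [exact/f0/e|exact/f1/e|exact/f2/e|exact/f3/e].
case=> lam [/f0 e0 /f1 e1 /f2 e2 /f3 e3].
by split; [exact: npos_noncollision|exists lam; apply: forall_I4].
Qed.

End Equations.

(** * The one-parameter family: bounds, uniqueness and existence *)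

Section Family.
Variable R : realType.
Implicit Types (m : 'I_4 -> R) (x y mu : R).

Lemma hyp_lt x y : 0 <= x -> x < y -> hyp x < hyp y.
Proof.
move=> x0 xy; have x2y2 : x ^+ 2 < y ^+ 2 by nra.
by rewrite ltr_sqrt ?ltrD2l // ltr_wpDr ?sqr_ge0 ?ltr01.
Qed.

Lemma hyp_ge1 x : 1 <= hyp x.
Proof. by rewrite -[leLHS]sqrtr1 ler_wsqrtr // lerDl sqr_ge0. Qed.

Lemma lt_hyp y : y < hyp y.
Proof.
have [y0|y0] := ltP y 0; first exact: lt_trans (hyp_gt0 y).
by rewrite -(ltr_pXn2r (ltn0Sn 1)) ?nnegrE // ?sqr_hyp; [lra|exact/ltW/hyp_gt0].
Qed.

Lemma hyp_lt2 x : (hyp x < 2) = (x ^+ 2 < 3).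
Proof.
rewrite -(ltr_pXn2r (ltn0Sn 1)) ?nnegrE //; last exact/ltW/hyp_gt0.
by rewrite sqr_hyp; apply/idP/idP; lra.
Qed.

Lemma icube_le (r s : R) : 0 < r -> r <= s -> icube s <= icube r.
Proof.
by move=> r0; rewrite le_eqVlt => /predU1P[->//|/(icube_lt r0)/ltW].
Qed.

Lemma icube2 : icube (2 : R) = 1 / 8.
Proof. by rewrite /icube; field. Qed.

Lemma cc_npos_base_masses m x y : (forall i, 0 < m i) -> 0 < x -> x < y ->
  central_configuration m (npos x y) -> m o0 = m o1.
Proof.
move=> m0 x0 xy /(cc_npos m0 x0 xy)[lam [_ _ [-> _] [+ _]]].
move/eqP; rewrite -subr_eq0 -mulrBr mulf_eq0 !subr_eq0 => /orP[/eqP//|/eqP AB].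
by have := icube_lt (hyp_gt0 x) (hyp_lt (ltW x0) xy); rewrite AB ltxx.
Qed.

(** Symmetry gives [cx = 0]; the base bodies then determine [lam] and [lam * cy], and substitution
    into the vertical equations of bodies 2 and 3 leaves these two. *)
Lemma cc_norm_masses mu x y : 0 < mu -> 0 < x -> x < y ->
  let A := icube (hyp x) in
  let B := icube (hyp y) in
  let D := icube (y - x) in
  central_configuration (norm_masses mu) (npos x y) <->
  mu * (y - x) * (D - B) = 2 * x * (A - 1 / 8) /\
  mu * (y - x) * (D - A) = 2 * y * (1 / 8 - B).
Proof.
move=> mu0 x0 xy A B D.
have m0 i : 0 < norm_masses mu i by rewrite /norm_masses; case: ifP.
apply: (iff_trans (cc_npos m0 x0 xy)); rewrite -/A -/B -/D /norm_masses /=.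
rewrite subrr !mul0r addr0 subr0.
set M := 1 + (1 + (mu + mu)).
have M0 : M != 0 by rewrite gt_eqF // !addr_gt0.
split.
  case=> lam [[]]; rewrite mulr1 => lE cy1 _ [_ e3] [_ e4].
  move: e3 e4; rewrite !mulrBr {}cy1 {}lE => e3 e4.
  by split; lra.
case=> e1 e2; exists (1 / 4 + mu * A + mu * B).
(* After clearing [M] and cancelling [mu], this is the difference of [e1] and [e2]. *)
have cy1 : (1 / 4 + mu * A + mu * B) * ((mu * x + mu * y) / M) =
           mu * x * A + mu * y * B.
  rewrite mulrA; apply/(canLR (mulfK M0)).
  have -> : (1 / 4 + mu * A + mu * B) * (mu * x + mu * y) =
    mu * ((1 / 4 + mu * A + mu * B) * (x + y)) by ring.
  have -> : (mu * x * A + mu * y * B) * M =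
    mu * ((x * A + y * B) * M) by ring.
  by congr (mu * _); rewrite /M; lra.
split; split; rewrite ?mulrBr ?cy1 ?mulr1 ?mulr0 //; lra.
Qed.

(** If [hyp x >= 2] then [B < A <= 1/8]; the second equation gives [D > A] and the first [D <= B], a
    contradiction. *)
Lemma cc_norm_lt2 mu x y : 0 < mu -> 0 < x -> x < y ->
  central_configuration (norm_masses mu) (npos x y) -> hyp x < 2.
Proof.
move=> mu0 x0 xy /(cc_norm_masses mu0 x0 xy)[e1 e2].
rewrite ltNge; apply/negP => a2.
have := icube_le (ltr0Sn _ 1) a2; rewrite icube2.
have := icube_lt (hyp_gt0 x) (hyp_lt (ltW x0) xy).
move: (icube _) (icube (hyp y)) (icube (y - x)) e1 e2 => A B D e1 e2 BA A8.
have h0 : 0 < mu * (y - x) by rewrite mulr_gt0 // subr_gt0.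
have : 0 < mu * (y - x) * (D - A).
  by rewrite e2 !mulr_gt0 //; [exact: lt_trans xy|lra].
have : mu * (y - x) * (D - B) <= 0.
  by rewrite e1 mulr_ge0_le0 //; lra.
rewrite pmulr_rgt0 // pmulr_rle0 //; lra.
Qed.

Lemma cc_norm_gt1 mu x y : 0 < mu -> 0 < x -> x < y ->
  central_configuration (norm_masses mu) (npos x y) -> 1 < y.
Proof.
(* If y <= 1 then y - x < 1 <= hyp x, while hyp y < 2. *)
move=> mu0 x0 xy /(cc_norm_masses mu0 x0 xy)[_ e2].
have y0 := lt_trans x0 xy; have h0 : 0 < y - x by rewrite subr_gt0.
rewrite ltNge; apply/negP => y1.
have y2 : hyp y < 2 by rewrite hyp_lt2; nra.
have B8 : 1 / 8 < icube (hyp y) by rewrite -icube2 icube_lt // hyp_gt0.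
have ha : y - x < hyp x by apply: lt_le_trans (hyp_ge1 x); lra.
have DA := icube_lt h0 ha.
have : 0 < mu * (y - x) * (icube (y - x) - icube (hyp x)).
  by rewrite !mulr_gt0 // subr_gt0.
by rewrite e2 pmulr_rgt0 ?mulr_gt0 // subr_gt0 ltNge (ltW B8).
Qed.

(** With [u = y^2] the square of this quantity is [u / (1 + u)^3], which decreases beyond [u = 1/2].
    It follows that [y (1/8 - B)] increases strictly. *)
Lemma mul_icube_hyp_anti y y' : 1 < y -> y < y' ->
  y' * icube (hyp y') <= y * icube (hyp y).
Proof.
move=> y1 yy; have y0 : 0 < y by lra.
have y'0 : 0 < y' by lra.
have B0 (t : R) : 0 < icube (hyp t) by apply/icube_gt0/hyp_gt0.
rewrite -(ler_pXn2r (ltn0Sn 1)) ?nnegrE ?mulr_ge0 ?(ltW (B0 _)) ?(ltW y0)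
  ?(ltW y'0) //.
have E t : (t * icube (hyp t)) ^+ 2 = t ^+ 2 / (1 + t ^+ 2) ^+ 3.
  by rewrite exprMn /icube exprVn -!exprM mulnC exprM sqr_hyp.
rewrite !E ler_pdivrMr; last by rewrite exprn_gt0 // ltr_wpDr ?sqr_ge0.
rewrite mulrAC ler_pdivlMr; last by rewrite exprn_gt0 // ltr_wpDr ?sqr_ge0.
have : 1 < y ^+ 2 by nra.
have : y ^+ 2 < y' ^+ 2 by nra.
move: (y ^+ 2) (y' ^+ 2) => u v uv u1.
rewrite -subr_ge0.
have -> : u * (1 + v) ^+ 3 - v * (1 + u) ^+ 3 =
  (v - u) * (3 * u * v + u * v * (u + v) - 1) by ring.
have uv1 : 1 < u * v by nra.
by rewrite mulr_ge0 //; [lra|nra].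
Qed.

(** From [y] to [y'], [hyp] grows less than [y - x] does and is the larger of the two, so
    [1 / (y - x)] drops by more than [1 / hyp y]. Factoring differences of cubes passes this on to
    the inverse cubes. *)
Lemma icube_gap_anti x y y' : 0 < x -> x < y -> y < y' ->
  icube (y' - x) - icube (hyp y') < icube (y - x) - icube (hyp y).
Proof.
move=> x0 xy yy; have y0 := lt_trans x0 xy; have y'0 := lt_trans y0 yy.
have [b0 b'0] := (hyp_gt0 y, hyp_gt0 y').
have h0 : 0 < y - x by rewrite subr_gt0.
have h'0 : 0 < y' - x by rewrite subr_gt0 (lt_trans xy).
have hb : y - x < hyp y by apply: lt_trans (lt_hyp y); lra.
have hb' : y' - x < hyp y' by apply: lt_trans (lt_hyp y'); lra.
have bb : hyp y < hyp y' by apply: hyp_lt => //; exact: ltW.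
(* The squares of [hyp] differ by [y'^2 - y^2], and [y + y' < hyp y + hyp y']. *)
have db : hyp y' - hyp y < y' - y.
  rewrite -(ltr_pM2r (addr_gt0 b'0 b0)) -subr_sqr !sqr_hyp.
  have -> : 1 + y' ^+ 2 - (1 + y ^+ 2) = (y' - y) * (y' + y) by ring.
  rewrite ltr_pM2l ?subr_gt0 //.
  by have := lt_hyp y; have := lt_hyp y'; lra.
rewrite /icube -!exprVn.
have XW : (hyp y)^-1 < (y - x)^-1 by rewrite ltf_pV2.
have XW' : (hyp y')^-1 < (y' - x)^-1 by rewrite ltf_pV2.
have W0 : 0 < (hyp y)^-1 by rewrite invr_gt0.
have W'0 : 0 < (hyp y')^-1 by rewrite invr_gt0.
have WW : (hyp y')^-1 < (hyp y)^-1 by rewrite ltf_pV2.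
have : (hyp y)^-1 - (hyp y')^-1 < (y - x)^-1 - (y' - x)^-1.
  have -> : (hyp y)^-1 - (hyp y')^-1 =
    (hyp y' - hyp y) * ((hyp y)^-1 * (hyp y')^-1).
    by field; rewrite !gt_eqF.
  have -> : (y - x)^-1 - (y' - x)^-1 =
    (y' - y) * ((y - x)^-1 * (y' - x)^-1) by field; rewrite !gt_eqF.
  apply: ltr_pM; rewrite ?mulr_ge0 ?subr_ge0 ?(ltW bb) ?(ltW W0) ?(ltW W'0) //.
  by rewrite ltr_pM // ltW.
move: (hyp y)^-1 (hyp y')^-1 (y - x)^-1 (y' - x)^-1 WW W0 W'0 XW XW'
  => W W' X X' WW W0 W'0 XW XW' d.
rewrite -subr_gt0.
have -> : X ^+ 3 - W ^+ 3 - (X' ^+ 3 - W' ^+ 3) =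
  (X - X') * (X ^+ 2 + X * X' + X' ^+ 2)
  - (W - W') * (W ^+ 2 + W * W' + W' ^+ 2) by ring.
rewrite subr_gt0; apply: ltr_pM => //; first by lra.
  by rewrite !addr_ge0 ?sqr_ge0 // mulr_ge0 // ltW.
by nra.
Qed.

Lemma icube_gap_gt0 x y : 0 < x -> x < y -> 0 < icube (y - x) - icube (hyp y).
Proof.
move=> x0 xy; rewrite subr_gt0 icube_lt ?subr_gt0 //.
by have := lt_hyp y; lra.
Qed.

(** The quotient of the two equations eliminates [mu]; writing [(D - A) / (D - B)] as
    [1 - (A - B) / (D - B)] makes the monotonicity in [y] visible. *)
Lemma cc_norm_mass_free mu x y : 0 < mu -> 0 < x -> x < y ->
  central_configuration (norm_masses mu) (npos x y) ->
  y * (1 / 8 - icube (hyp y)) =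
  x * (icube (hyp x) - 1 / 8) *
  (1 - (icube (hyp x) - icube (hyp y)) / (icube (y - x) - icube (hyp y))).
Proof.
move=> mu0 x0 xy /(cc_norm_masses mu0 x0 xy)[].
have /gt_eqF/negbT := icube_gap_gt0 x0 xy.
move: (icube (hyp x)) (icube (hyp y)) (icube (y - x)) => A B D g0 e1 e2.
apply: (mulIf g0); rewrite -[RHS]mulrA [in RHS]mulrBl divfK // mul1r.
have two0 : 2 != 0 :> R by rewrite pnatr_eq0.
apply: (mulfI two0).
transitivity (2 * y * (1 / 8 - B) * (D - B)); first by ring.
rewrite -e2; transitivity (mu * (y - x) * (D - B) * (D - A)); first by ring.
by rewrite e1; ring.
Qed.

Lemma cc_norm_unique mu mu' x y y' : 0 < mu -> 0 < mu' ->
  0 < x -> x < y -> x < y' ->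
  central_configuration (norm_masses mu) (npos x y) ->
  central_configuration (norm_masses mu') (npos x y') ->
  y' = y /\ mu' = mu.
Proof.
move=> mu0 mu'0 x0 xy xy' cc cc'.
have yy : y' = y.
  wlog : mu mu' y y' mu0 mu'0 xy xy' cc cc' / y < y'.
    move=> H; have [lt|lt|//] := ltgtP y y'.
      exact: H mu0 mu'0 xy xy' cc cc' lt.
    by apply/esym; exact: H mu'0 mu0 xy' xy cc' cc lt.
  move=> yy; exfalso.
  have y0 : 0 < y by apply: lt_trans xy.
  have y1 := cc_norm_gt1 mu0 x0 xy cc.
  have e := cc_norm_mass_free mu0 x0 xy cc.
  have e' := cc_norm_mass_free mu'0 x0 xy' cc'.
  have A8 : 1 / 8 < icube (hyp x).
    by rewrite -icube2 icube_lt ?hyp_gt0 // (cc_norm_lt2 mu0 x0 xy cc).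
  have yB := mul_icube_hyp_anti y1 yy.
  have BA := icube_lt (hyp_gt0 x) (hyp_lt (ltW x0) xy).
  have BB := icube_lt (hyp_gt0 y) (hyp_lt (ltW y0) yy).
  have g := icube_gap_anti x0 xy yy.
  have g'0 := icube_gap_gt0 x0 xy'.
  have g0 := icube_gap_gt0 x0 xy.
  have K0 : 0 < x * (icube (hyp x) - 1 / 8) by rewrite mulr_gt0 // subr_gt0.
  (* The numerator [A - B] increases with [y] and the positive denominator [D - B] decreases. *)
  have : (icube (hyp x) - icube (hyp y)) / (icube (y - x) - icube (hyp y)) <
    (icube (hyp x) - icube (hyp y')) / (icube (y' - x) - icube (hyp y')).
    apply: ltr_pM.
    - by rewrite subr_ge0 ltW.
    - by rewrite invr_ge0 ltW.
    - by rewrite ltrD2l ltrN2.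
    - by rewrite ltf_pV2.
  rewrite -(ltr_pM2l K0) => lt.
  by move: e e'; rewrite !(mulrBr _ 1) !mulr1; lra.
split=> //; subst y'.
have [e1 _] := (cc_norm_masses mu0 x0 xy).1 cc.
have [e1' _] := (cc_norm_masses mu'0 x0 xy).1 cc'.
have g0 := icube_gap_gt0 x0 xy.
have h0 : y - x != 0 by rewrite subr_eq0 gt_eqF.
apply: (mulIf h0); apply: (mulIf (negbT (gt_eqF g0))).
by rewrite e1 e1'.
Qed.

Lemma hyp_continuous : continuous (@hyp R).
Proof.
move=> t; apply: (continuous_comp (f := fun s : R => 1 + s ^+ 2)).
  by apply: cvgD; [exact: cvg_cst|exact: exprn_continuous].
exact: sqrt_continuous.
Qed.

(* With K = x (A-1/8) and A = icube (hyp x), this is the cleared form of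
   t (1/8-B) (D-B) - K (D-A). *)
Lemma balance_continuous x K A : continuous (fun t : R =>
  t * (hyp t ^+ 3 / 8 - 1) * (hyp t ^+ 3 - (t - x) ^+ 3)
  - K * hyp t ^+ 6 * (1 - A * (t - x) ^+ 3)).
Proof.
move=> t.
have cX n (f : R -> R) : {for t, continuous f} ->
    {for t, continuous (fun s => f s ^+ n)}.
  move=> cf; apply: (@continuous_comp _ _ _ f (fun u : R => u ^+ n) _ cf).
  exact: exprn_continuous.
have ch : {for t, continuous (@hyp R)} by exact: hyp_continuous.
have cd : {for t, continuous (fun s : R => s - x)}.
  by apply: cvgB; [exact: cvg_id|exact: cvg_cst].
apply: cvgB; apply: cvgM.
- apply: cvgM; first exact: cvg_id.
  by apply: cvgB; [apply: cvgMl; exact: cX|exact: cvg_cst].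
- by apply: cvgB; exact: cX.
- by apply: cvgMr; exact: cX.
- by apply: cvgB; [exact: cvg_cst|apply: cvgMr; exact: cX].
Qed.

Lemma cc_norm_exists x : 0 < x -> hyp x < 2 -> exists y mu,
  [/\ x < y, 0 < mu & central_configuration (norm_masses mu) (npos x y)].
Proof.
move=> x0 a2; have a0 := hyp_gt0 x.
pose A := icube (hyp x); pose K := x * (A - 1 / 8).
have A8 : 1 / 8 < A by rewrite -icube2 icube_lt.
have K0 : 0 < K by rewrite mulr_gt0 // subr_gt0.
(* The clearing factor is [hyp t ^+ 6 * (t - x) ^+ 3], nonzero for [t > x]. *)
pose G t := t * (hyp t ^+ 3 / 8 - 1) * (hyp t ^+ 3 - (t - x) ^+ 3)
  - K * hyp t ^+ 6 * (1 - A * (t - x) ^+ 3).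
have [y [xy Gy]] : exists y, x < y /\ G y = 0.
  pose t1 : R := Num.sqrt 3; pose t2 := x + hyp x.
  have t1sq : t1 ^+ 2 = 3 by rewrite sqr_sqrtr.
  have t10 : 0 < t1 by rewrite sqrtr_gt0.
  have xt1 : x < t1 by move: a2; rewrite hyp_lt2; nra.
  have xt2 : x < t2 by rewrite ltrDl.
  have b1 : hyp t1 = 2.
    by rewrite /hyp t1sq (_ : 1 + 3 = 2 ^+ 2) ?sqrtr_sqr ?ger0_norm //; ring.
  have K64 : 0 < K * 64 by lra.
  have Aa : A * hyp x ^+ 3 = 1 by rewrite mulVf // expf_neq0 // gt_eqF.
  have G1 : G t1 = K * 64 * (A * (t1 - x) ^+ 3 - A * hyp x ^+ 3).
    by rewrite /G b1 Aa; field.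
  have G2 : G t2 = t2 * (hyp t2 ^+ 3 - 2 ^+ 3) * (hyp t2 ^+ 3 - hyp x ^+ 3) / 8.
    by rewrite /G /t2 addrAC subrr add0r Aa; field.
  have bt2 : 0 <= hyp t2 ^+ 3 - hyp x ^+ 3.
    rewrite subr_ge0 ler_pXn2r ?nnegrE ?(ltW (hyp_gt0 _)) //.
    by rewrite ltW // hyp_lt // ltW.
  have t20 : 0 < t2 by rewrite (lt_trans x0).
  have cG S := @continuous_subspaceT _ _ S _ (@balance_continuous x K A).
  (* One term of [G] vanishes at each endpoint: [G t1] has the sign of [t1 - t2] and [G t2] that of
     [t2 - t1]. So [G] has a zero between them in either order. *)
  have [t12|t21] := leP t1 t2.
    have G1le : G t1 <= 0.
      rewrite G1 (pmulr_rle0 _ K64) -mulrBr pmulr_rle0 ?icube_gt0 //.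
      by rewrite subr_le0 ler_pXn2r ?nnegrE ?subr_ge0 ?(ltW xt1) ?(ltW a0) //;
        rewrite /t2 in t12; lra.
    have G2ge : 0 <= G t2.
      rewrite G2; apply: mulr_ge0; last by rewrite invr_ge0.
      apply: mulr_ge0 => //; apply: mulr_ge0; first exact: ltW.
      rewrite subr_ge0 ler_pXn2r ?nnegrE ?(ltW (hyp_gt0 _)) //.
      rewrite -b1; move: t12; rewrite le_eqVlt => /predU1P[->//|].
      by move/(hyp_lt (ltW t10))/ltW.
    have [|y] := @IVT R G t1 t2 0 t12 (cG _).
      by rewrite ge_min le_max G1le G2ge orbT.
    by rewrite in_itv /= => /andP[t1y _] Gy; exists y; split=> //;
      exact: lt_le_trans t1y.
  have G1ge : 0 <= G t1.
    rewrite G1 (pmulr_rge0 _ K64) -mulrBr pmulr_rge0 ?icube_gt0 //.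
    by rewrite subr_ge0 ler_pXn2r ?nnegrE ?subr_ge0 ?(ltW xt1) ?(ltW a0) //;
        rewrite /t2 in t21; lra.
  have G2le : G t2 <= 0.
    rewrite G2; apply: mulr_le0_ge0; last by rewrite invr_ge0.
    apply: mulr_le0_ge0 => //; apply: mulr_ge0_le0; first exact: ltW.
    rewrite subr_le0 ler_pXn2r ?nnegrE ?(ltW (hyp_gt0 _)) //.
    by rewrite -b1 ltW // hyp_lt // ltW.
  have [|y] := @IVT R G t2 t1 0 (ltW t21) (cG _).
    by rewrite ge_min le_max G1ge G2le orbT.
  by rewrite in_itv /= => /andP[t2y _] Gy; exists y; split=> //;
      exact: lt_le_trans t2y.
have g0 := icube_gap_gt0 x0 xy.
have h0 : 0 < y - x by rewrite subr_gt0.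
have b0 := hyp_gt0 y.
pose B := icube (hyp y); pose D := icube (y - x).
have Gfactor : y * (1 / 8 - B) * (D - B) = K * (D - A).
  have w0 : hyp y ^+ 6 * (y - x) ^+ 3 != 0.
    by rewrite mulf_neq0 ?expf_neq0 ?gt_eqF.
  apply: (mulIf w0); apply/eqP; rewrite -subr_eq0 -Gy /G /B /D /icube.
  by apply/eqP; field; rewrite !gt_eqF.
(* The first equation solved for [mu]; the second then follows from [Gfactor]. *)
pose mu := 2 * K / ((y - x) * (D - B)).
have mu0 : 0 < mu by apply: divr_gt0; apply: mulr_gt0; rewrite ?ltr0n.
have muE : mu * (y - x) * (D - B) = 2 * K.
  by rewrite -mulrA divfK // mulf_neq0 // gt_eqF.
exists y, mu; split=> //; apply/(cc_norm_masses mu0 x0 xy).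
rewrite -/A -/B -/D muE; split; first by rewrite /K; ring.
apply: (mulIf (negbT (gt_eqF g0))); rewrite -/B -/D.
transitivity (mu * (y - x) * (D - B) * (D - A)); first by ring.
rewrite muE; transitivity (2 * (K * (D - A))); first by ring.
by rewrite -Gfactor; ring.
Qed.

End Family.

(** * Return to arbitrary configurations and to side lengths *)

Section Classification.
Variable R : realType.
Implicit Types (m : 'I_4 -> R) (q : 'I_4 -> pt R) (z w : pt R) (x y a b mu : R).

(** Either the base is one of the given pairs and the axis bodies the other, or the pairs run across
    and equality on the base makes all four masses equal. *)
Lemma two_pairs_axis m (sigma : 'I_4 -> 'I_4) : injective sigma ->
  two_pairs_equal m -> m (sigma o0) = m (sigma o1) ->
  m (sigma o2) = m (sigma o3).
Proof.
move=> sI [i [j [k [l [D [eij ekl]]]]]].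
have [g _ gK] := injF_bij sI.
have {}D : distinct4 (g i) (g j) (g k) (g l).
  by rewrite /distinct4 !(inj_eq (can_inj gK)).
rewrite -(gK i) -(gK j) in eij; rewrite -(gK k) -(gK l) in ekl.
move: (g i) (g j) (g k) (g l) D eij ekl.
by do 4![apply: forall_I4 => //]; move=> _; congruence.
Qed.

Lemma norm_posE x y : 0 <= x -> 0 <= y ->
  norm_pos (hyp x) (hyp y) = npos x y.
Proof.
have sK t : 0 <= t -> Num.sqrt (hyp t ^+ 2 - 1) = t.
  by move=> t0; rewrite sqr_hyp addrAC subrr add0r sqrtr_sqr ger0_norm.
move=> x0 y0; rewrite -[LHS]/(npos (Num.sqrt (hyp x ^+ 2 - 1))
                                   (Num.sqrt (hyp y ^+ 2 - 1))).
by rewrite !sK.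
Qed.

Lemma hyp_sqrt a : 1 <= a -> hyp (Num.sqrt (a ^+ 2 - 1)) = a.
Proof.
move=> a1; rewrite /hyp sqr_sqrtr; last by nra.
by rewrite addrC subrK sqrtr_sqr ger0_norm //; lra.
Qed.

Lemma framed_symmetry q sigma z w x y : framed q sigma z w x y ->
  symmetry_axis q (sigma o2) (sigma o3) /\
  reflect_line (q (sigma o2)) (q (sigma o3)) (q (sigma o0)) = q (sigma o1).
Proof.
case=> sI w0 xy e.
have refl i : reflect_line (q (sigma o2)) (q (sigma o3)) (q (sigma i)) =
              q (sigma (sel4 o1 o0 o2 o3 i)).
  rewrite !e reflect_sim //; congr sim.
  by move: i; apply: forall_I4; rewrite /npos /sel4 /= ?opprK ?oppr0.
split; last exact: refl.
split; first by rewrite (inj_eq sI).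
split=> [|i].
  by rewrite !e => /(sim_inj w0) [] /eqP; rewrite (negPf xy).
have [g _ gK] := injF_bij sI.
by exists (sigma (sel4 o1 o0 o2 o3 (g i))); rewrite -refl gK.
Qed.

Lemma npos_interior x y : 0 < x -> x < y ->
  in_triangle_interior (npos x y o2) (npos x y o0) (npos x y o1) (npos x y o3).
Proof.
move=> x0 xy; have y0 := lt_trans x0 xy.
have xy0 : 0 < x / y by rewrite divr_gt0.
have xy1 : x / y < 1 by rewrite ltr_pdivrMr // mul1r.
(* The height fixes the weight [x / y] of the apex, and symmetry splits the rest evenly. *)
exists ((1 - x / y) / 2), ((1 - x / y) / 2), (x / y).
split; first by lra.
split; first by lra.
split=> //; split; first by field; rewrite gt_eqF.
by rewrite /npos /sel4 /=; congr (_, _); field; rewrite gt_eqF.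
Qed.

Lemma sim_similar_image q (q' : 'I_4 -> pt R) z w :
  w.1 ^+ 2 + w.2 ^+ 2 != 0 -> (forall i, q' i = sim z w (q i)) ->
  similar_image q q'.
Proof.
move=> w0 e; set s := Num.sqrt (w.1 ^+ 2 + w.2 ^+ 2).
have s0 : 0 < s by rewrite sqrtr_gt0 lt0r w0 addr_ge0 ?sqr_ge0.
have sn : s != 0 by rewrite gt_eqF.
exists s, (w.1 / s), (w.2 / s), z.1, z.2; split=> //; split.
  rewrite !expr_div_n -mulrDl -[X in X / _]sqr_sqrtr ?addr_ge0 ?sqr_ge0 //.
  by rewrite divff // expf_neq0.
by move=> i; rewrite e /sim; congr (_, _); field.
Qed.

End Classification.

Theorem theorem1 (R : realType) :
  (* (1) shape of concave kite CCs with two pairs of equal masses *)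
  (forall (m : 'I_4 -> R) (q : 'I_4 -> pt R),
     (forall i, 0 < m i) ->
     central_configuration m q -> kite q -> concave q -> two_pairs_equal m ->
     (exists i j k l : 'I_4,
        [/\ distinct4 i j k l, m i = m j, m k = m l,
            symmetry_axis q k l /\
            reflect_line (q k) (q l) (q i) = q j &
            (in_triangle_interior (q k) (q i) (q j) (q l) \/
             in_triangle_interior (q l) (q i) (q j) (q k))])
     /\
     (* (2) up to equivalence (and relabelling / scaling of masses) it is a
        normalized configuration with parameter a in (1,2) *)
     (exists (sigma : 'I_4 -> 'I_4) (c a b mu : R),
        [/\ injective sigma, 0 < c, 1 < a /\ a < 2, a < b & 0 < mu] /\
        central_configuration (norm_masses mu) (norm_pos a b) /\
        (forall i, m (sigma i) = c * norm_masses mu i) /\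
        similar_image (norm_pos a b) (fun i => q (sigma i))))
  /\
  (* (3) in normalized form, only a in (1,2) occurs *)
  (forall a b mu : R, 1 < a -> a < b -> 0 < mu ->
     central_configuration (norm_masses mu) (norm_pos a b) -> a < 2)
  /\
  (* (4) each a in (1,2) uniquely determines b and the mass ratio mu > 0 *)
  (forall a : R, 1 < a -> a < 2 ->
     exists b mu : R, [/\ a < b, 0 < mu &
        central_configuration (norm_masses mu) (norm_pos a b)] /\
       forall b' mu' : R, a < b' -> 0 < mu' ->
         central_configuration (norm_masses mu') (norm_pos a b') ->
         b' = b /\ mu' = mu).
Proof.
have ht (a : R) : 1 < a ->
    0 < Num.sqrt (a ^+ 2 - 1) /\ hyp (Num.sqrt (a ^+ 2 - 1)) = a.
  move=> a1; split; last by rewrite hyp_sqrt // ltW.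
  by rewrite sqrtr_gt0; nra.
have lt (a b : R) : 1 < a -> a < b ->
    Num.sqrt (a ^+ 2 - 1) < Num.sqrt (b ^+ 2 - 1).
  by move=> a1 ab; rewrite ltr_sqrt; nra.
split; [|split].
- move=> m q m0 cc kq cq pq.
  have [sigma [z [w [x [y [fr x0 xy]]]]]] := concave_kite_framed kq cq.
  have [sI w0 _ e] := fr.
  pose m' i := m (sigma i).
  have m'0 i : 0 < m' i by exact: m0.
  have cc' : central_configuration m' (npos x y).
    apply: (cc_sim m'0 w0 (z := z)).
    by rewrite -(funext e); exact: cc_reindex.
  have m01 := cc_npos_base_masses m'0 x0 xy cc'.
  have m23 : m' o2 = m' o3 by exact: two_pairs_axis pq m01.
  have y0 := lt_trans x0 xy.
  split.
    have [sym rfl] := framed_symmetry fr.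
    exists (sigma o0), (sigma o1), (sigma o2), (sigma o3); split=> //.
      by rewrite /distinct4 !(inj_eq sI).
    by left; rewrite !e; apply: sim_interior; exact: npos_interior.
  have c0 : m' o0 != 0 by rewrite gt_eqF.
  (* Dividing all masses by that of a base body normalizes the base masses to 1. *)
  pose mu := m' o2 / m' o0.
  have mu0 : 0 < mu by rewrite divr_gt0.
  have mE : m' = fun i => m' o0 * norm_masses mu i.
    apply: funext; apply: forall_I4; rewrite /norm_masses /= ?mulr1 //.
      by rewrite mulrC divfK.
    by rewrite mulrC divfK.
  have ccn : central_configuration (norm_masses mu) (npos x y).
    by apply: (cc_scale (m'0 o0)); rewrite -mE.
  have x1 : 1 < hyp x.
    by rewrite -(ltr_pXn2r (ltn0Sn 1)) ?nnegrE ?(ltW (hyp_gt0 _)) // sqr_hyp;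
      nra.
  exists sigma, (m' o0), (hyp x), (hyp y), mu.
  rewrite norm_posE ?ltW //; split.
    split=> //; first by split=> //; exact: cc_norm_lt2 ccn.
    by apply: hyp_lt => //; exact: ltW.
  split=> //; split; first by move=> i; rewrite -[LHS]/(m' i) {1}mE.
  exact: sim_similar_image w0 e.
- move=> a b mu a1 ab mu0 cc; have [x0 <-] := ht _ a1.
  exact: cc_norm_lt2 mu0 x0 (lt _ _ a1 ab) cc.
- move=> a a1 a2; have [x0 aE] := ht _ a1.
  have [|y [mu [xy mu0 cc]]] := cc_norm_exists x0; first by rewrite aE.
  have y0 := lt_trans x0 xy.
  exists (hyp y), mu; split.
    rewrite -{2}aE norm_posE ?ltW //; split=> //.
    by rewrite -aE hyp_lt // ltW.
  move=> b' mu' ab' mu'0 cc'.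
  have [_ bE] := ht _ (lt_trans a1 ab').
  have [yE muE] := cc_norm_unique mu0 mu'0 x0 xy (lt _ _ a1 ab') cc cc'.
  by rewrite -bE yE.
Qed.
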